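(* Thompson's group $V$ is $(2,3)$-generated, that is, there exist $\alpha, \beta \in V$ with $\alpha$ of order $2$, $\beta$ of order $3$ and $V = \langle \alpha, \beta \rangle$.
   Context: Let $\mathfrak{C} = \{0,1\}^{\omega}$ be Cantor space. For $u \in \{0,1\}^*$ let $u\mathfrak{C} = \{uw \mid w \in \mathfrak{C}\}$. A finite set $A \subseteq \{0,1\}^*$ is a basis of $\mathfrak{C}$ if $\{u\mathfrak{C} \mid u \in A\}$ is a partition of $\mathfrak{C}$. Thompson's group $V$ is the group of homeomorphisms $\gamma$ of $\mathfrak{C}$ (acting on the right) for which there exists a bijection $g\colon A \to B$ between two bases $A$ and $B$ of $\mathfrak{C}$ such that $(uw)\gamma = (ug)w$ for all $u \in A$ and $w \in \mathfrak{C}$. *)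

(* Defs.v *)
From HB Require Import structures.
From mathcomp Require Import all_boot.
From mathcomp Require Import boolp classical_sets functions cardinality.
From mathcomp Require Import topology cantor.

Set Implicit Arguments.
Unset Strict Implicit.
Unset Printing Implicit Defensive.

Local Open Scope classical_set_scope.

Record homeo (T : topologicalType) := Homeo {
  homeo_fun :> T -> T;
  homeo_inv : T -> T;
  homeo_continuous : continuous homeo_fun;
  homeo_inv_continuous : continuous homeo_inv;
  homeoK : cancel homeo_fun homeo_inv;
  homeo_invK : cancel homeo_inv homeo_fun
}.

Section HomeoGroup.
Variable T : topologicalType.
Implicit Types f g h : homeo T.

Lemma homeo_ext f g : f =1 g -> f = g.
Proof.
case: f g => [f f' cf cf' fK f'K] [g g' cg cg' gK g'K] /= /funext fg.
have fg' : f' = g' by apply/funext => x; apply: (can_inj gK); rewrite g'K -fg f'K.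
by subst g g'; f_equal; exact: Prop_irrelevance.
Qed.

Definition homeo_one : homeo T :=
  @Homeo T id id (fun=> cvg_id) (fun=> cvg_id) (fun=> erefl) (fun=> erefl).

Definition homeo_invg f : homeo T :=
  Homeo (@homeo_inv_continuous T f) (@homeo_continuous T f)
        (@homeo_invK T f) (@homeoK T f).

Lemma continuous_comp_fun (f g : T -> T) :
  continuous f -> continuous g -> continuous (g \o f).
Proof. by move=> cf cg x; apply: continuous_comp; [exact: cf|exact: cg]. Qed.

(* Homeomorphisms act on the right: x (f g) = (x f) g. *)
Definition homeo_mul f g : homeo T :=
  Homeo (continuous_comp_fun (@homeo_continuous T f) (@homeo_continuous T g))
        (continuous_comp_fun (@homeo_inv_continuous T g)
                             (@homeo_inv_continuous T f))
        (can_comp (@homeoK T g) (@homeoK T f))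
        (can_comp (@homeo_invK T f) (@homeo_invK T g)).

Lemma homeo_mulA : associative homeo_mul.
Proof. by move=> f g h; exact: homeo_ext. Qed.

Lemma homeo_mul1 : left_id homeo_one homeo_mul.
Proof. by move=> f; exact: homeo_ext. Qed.

Lemma homeo_mulr1 : right_id homeo_one homeo_mul.
Proof. by move=> f; exact: homeo_ext. Qed.

Lemma homeo_mulV : left_inverse homeo_one homeo_invg homeo_mul.
Proof. by move=> f; apply: homeo_ext => x /=; rewrite homeo_invK. Qed.

Lemma homeo_mulrV : right_inverse homeo_one homeo_invg homeo_mul.
Proof. by move=> f; apply: homeo_ext => x /=; rewrite homeoK. Qed.

HB.instance Definition _ := gen_eqMixin (homeo T).
HB.instance Definition _ := gen_choiceMixin (homeo T).
HB.instance Definition _ := isGroup.Build (homeo T)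
  homeo_mulA homeo_mul1 homeo_mulr1 homeo_mulV homeo_mulrV.
End HomeoGroup.

Definition has_order (G : groupType) (x : G) (n : nat) : Prop :=
  [/\ (0 < n)%N, (x ^+ n = 1)%g &
      forall m : nat, (0 < m < n)%N -> (x ^+ m <> 1)%g].

Definition subgroup_generated (G : groupType) (S : set G) : set G :=
  smallest [set H : set G | group_closed (mem H)] S.

Definition prepend (u : seq bool) (w : cantor_space) : cantor_space :=
  fun n => if (n < size u)%N then nth false u n else w (n - size u)%N.

Definition cone (u : seq bool) : set cantor_space := range (prepend u).

Definition cantor_basis (A : set (seq bool)) : Prop :=
  finite_set A /\ partition [set cone u | u in A] id [set: cantor_space].

(* g is a total function, of which only the values on A matter. *)
Definition thompsonV : set (homeo cantor_space) :=
  [set gamma | exists (A B : set (seq bool)) (g : seq bool -> seq bool),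
    [/\ cantor_basis A, cantor_basis B, set_bij A B g &
        forall (u : seq bool) (w : cantor_space), A u ->
          gamma (prepend u w) = prepend (g u) w]].

(* Main.v *)
Require Import Defs.
From Stdlib Require Import Ascii String.
From mathcomp Require Import all_boot zify.
From mathcomp Require Import boolp classical_sets functions cardinality.
From mathcomp Require Import topology cantor.

(**
The swap (u v) of two incomparable words exchanges the cones of u and v. The
swaps generate V: given a bijection between two bases, multiply by swaps until
two sibling words u0, u1 of the first basis are sent to sibling words v0, v1 of
the second one, replace the four words by u and v, and induct on the size of the
bases. Conjugation by swaps and (u v) = (u0 v0) (u1 v1) reduce every swap to the
swaps (x y) with |x| = 2 or 3 and |y| = 2.

The generators alpha = (10 11) (001 0000) and beta = (0 111 110) (1000 1001 101)
come from a computer search. Put w = ab ab^-1 ab ab ab^-1 ab^-1, with a = alpha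
and b = beta; w has order 70, and w^35 is the single swap (100000 10001). From
it, conjugation by a, b, b^-1 and by the swaps already obtained, together with
(u v) = (u0 v0) (u1 v1), produces all the short swaps.
*)

Set Implicit Arguments.
Unset Strict Implicit.
Unset Printing Implicit Defensive.

Local Open Scope classical_set_scope.

(** * Swaps of cones *)

Lemma nbhs_initial_segment (p : cantor_space) N :
  nbhs p [set q : cantor_space | forall k, k < N -> p k = q k].
Proof.
elim: N => [|N IH]; first by apply: filterS filterT.
have : nbhs p [set q : cantor_space | p N = q N].
  have := @proj_continuous nat (fun=> bool) N p [set b | p N = b].
  apply; suff -> : [set b | p N = b] = [set (p N : bool)] by exact: (@discrete_set1 bool).
  by apply/seteqP; split=> b.
apply: filterS2 IH => q /= qlt qN k; rewrite ltnS leq_eqVlt => /predU1P[->//|].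
exact: qlt.
Qed.

(** The topology is the product of discrete ones, so continuity is tested on each coordinate, and a
    coordinate read off finitely many letters is locally constant. *)
Lemma continuous_finite_dependence (f : cantor_space -> cantor_space) :
  (forall n, exists N, forall p q : cantor_space,
     (forall k, k < N -> p k = q k) -> f p n = f q n) ->
  continuous f.
Proof.
move=> floc p; apply/cvg_sup => n; apply/cvg_image.
  by apply/seteqP; split=> // b _; exists (fun=> b).
move=> U /= /nbhs_singleton Up; exists ((fun q : cantor_space => q n) @^-1` U).
  have [N fN] := floc n.
  by apply: filterS (nbhs_initial_segment p N) => q /fN /= <-.
by rewrite image_preimage //; apply/seteqP; split=> // b _; exists (fun=> b).
Qed.

Definition starts (u : seq bool) (p : cantor_space) := u == mkseq p (size u).

Definition tail n (p : cantor_space) : cantor_space := fun k => p (n + k).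

Definition incomparable (u v : seq bool) := ~~ prefix u v && ~~ prefix v u.

Lemma startsP u p : reflect (prepend u (tail (size u) p) = p) (starts u p).
Proof.
apply: (iffP eqP) => [eu|<-].
  apply/funext => k; rewrite /prepend /tail.
  case: ltnP => [ku|uk]; last by rewrite subnKC.
  by rewrite eu nth_mkseq.
apply: (@eq_from_nth _ false); first by rewrite size_mkseq.
by move=> k ku; rewrite nth_mkseq // /prepend ku.
Qed.

Lemma tail_prepend u w : tail (size u) (prepend u w) = w.
Proof.
by apply/funext => k; rewrite /tail /prepend ltnNge leq_addr /= addKn.
Qed.

Lemma starts_prependT u w : starts u (prepend u w).
Proof. by apply/startsP; rewrite tail_prepend. Qed.

Lemma prepend0 w : prepend [::] w = w.
Proof. by apply/funext => k; rewrite /prepend /= subn0. Qed.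

Lemma prepend_cat u v w : prepend (u ++ v) w = prepend u (prepend v w).
Proof.
apply/funext => k; rewrite /prepend size_cat nth_cat.
case: ltnP => [kuv|uvk]; case: ltnP => [ku|uk] //.
- by rewrite ltn_subLR // kuv.
- by move: (leq_trans ku (leq_trans (leq_addr _ _) uvk)); rewrite ltnn.
- by rewrite ltn_subLR // ltnNge uvk /= subnDA.
Qed.

Lemma starts_prepend u v w : size u <= size v -> starts u (prepend v w) = prefix u v.
Proof.
move=> uv; rewrite /starts prefixE eq_sym; congr (_ == _).
apply: (@eq_from_nth _ false); rewrite size_mkseq ?size_takel // => k ku.
by rewrite nth_mkseq // nth_take // /prepend (leq_trans ku uv).
Qed.

Lemma starts_cat u v p : starts (u ++ v) p = starts u p && starts v (tail (size u) p).
Proof.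
apply/startsP/andP => [<-|[/startsP up /startsP vp]].
  by rewrite prepend_cat starts_prependT tail_prepend starts_prependT.
rewrite prepend_cat -[RHS]up; congr prepend; rewrite -[RHS]vp; congr prepend.
by apply/funext => k; rewrite /tail size_cat addnA.
Qed.

Lemma starts_prefix u v p : prefix u v -> starts v p -> starts u p.
Proof. by case/prefixP=> x ->; rewrite starts_cat => /andP[]. Qed.

Lemma starts_comparable u v p : starts u p -> starts v p -> size u <= size v -> prefix u v.
Proof. by move=> up /startsP pv uv; rewrite -(starts_prepend (tail (size v) p)) // pv. Qed.

Lemma incomparableC u v : incomparable u v = incomparable v u.
Proof. by rewrite /incomparable andbC. Qed.

(** Two prefixes of one point are comparable, and a word and any prefix of it share a point; so
    incomparability is disjointness of cones. *)
Lemma incomparableP u v :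
  reflect (forall p, starts u p -> ~~ starts v p) (incomparable u v).
Proof.
apply: (iffP andP) => [[uv vu] p up|disj].
  apply/negP => vp; case: (leqP (size u) (size v)) => [le|/ltnW le].
    by rewrite (starts_comparable up vp le) in uv.
  by rewrite (starts_comparable vp up le) in vu.
split; apply/negP=> pre.
  have vp := starts_prependT v point.
  by move: (disj _ (starts_prefix pre vp)); rewrite vp.
have up := starts_prependT u point.
by move: (disj _ up); rewrite (starts_prefix pre up).
Qed.

Lemma incomparable_starts u v p : incomparable u v -> starts u p -> starts v p = false.
Proof. by move=> /incomparableP /[apply] /negPf. Qed.

(* The swap of comparable words is the identity, so that no side condition is needed. *)
Definition swap_fun u v p :=
  if ~~ incomparable u v then p
  else if starts u p then prepend v (tail (size u) p)
  else if starts v p then prepend u (tail (size v) p)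
  else p.

Lemma swap_funK u v : involutive (swap_fun u v).
Proof.
move=> p; rewrite /swap_fun; case uv: (incomparable u v) => //=.
have vu : incomparable v u by rewrite incomparableC.
case up: (starts u p) => /=.
  rewrite (incomparable_starts vu (starts_prependT _ _)) starts_prependT tail_prepend.
  exact/startsP.
case vp: (starts v p) => /=; last by rewrite up vp.
by rewrite starts_prependT tail_prepend; apply/startsP.
Qed.

Lemma eq_starts u (p q : cantor_space) :
  (forall k, k < size u -> p k = q k) -> starts u p = starts u q.
Proof.
move=> pq; congr (_ == _).
by apply: (@eq_from_nth _ false); rewrite !size_mkseq // => k ku; rewrite !nth_mkseq // pq.
Qed.

Lemma swap_fun_continuous u v : continuous (swap_fun u v).
Proof.
(* The tests read at most the first |u| or |v| letters, and replacing one prefix by the other shifts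
   positions by at most |u| + |v|. *)
apply: continuous_finite_dependence => n; exists (n.+1 + (size u + size v)) => p q pq.
have agree k : k <= n + (size u + size v) -> p k = q k.
  by move=> kn; apply: pq; rewrite addSn ltnS.
have eqU : starts u p = starts u q.
  by apply: eq_starts => k ku; apply: agree; move: ku; clear; lia.
have eqV : starts v p = starts v q.
  by apply: eq_starts => k ku; apply: agree; move: ku; clear; lia.
have pn : p n = q n by apply: agree; rewrite leq_addr.
have eq_prep x y : size y <= size u + size v ->
    prepend x (tail (size y) p) n = prepend x (tail (size y) q) n.
  move=> ys; rewrite /prepend /tail; case: ifP => // _; apply: agree.
  by rewrite addnC leq_add // leq_subr.
rewrite /swap_fun eqU eqV; case: ifP => // _; case: ifP => // _; last case: ifP => // _.
  by apply: eq_prep; rewrite leq_addr.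
by apply: eq_prep; rewrite leq_addl.
Qed.

Definition swap u v : homeo cantor_space :=
  Homeo (@swap_fun_continuous u v) (@swap_fun_continuous u v)
        (@swap_funK u v) (@swap_funK u v).

Lemma swapK u v : (swap u v * swap u v)%g = 1%g.
Proof. by apply: homeo_ext => p; exact: swap_funK. Qed.

Lemma swapV u v : ((swap u v)^-1)%g = swap u v.
Proof. exact: homeo_ext. Qed.

Lemma swapC u v : swap u v = swap v u.
Proof.
apply: homeo_ext => p /=; rewrite /swap_fun incomparableC.
case vu: (incomparable v u) => //=; case vp: (starts v p) => //.
by rewrite (incomparable_starts vu vp).
Qed.

Lemma swap_comparable u v : ~~ incomparable u v -> swap u v = 1%g.
Proof. by move=> uv; apply: homeo_ext => p /=; rewrite /swap_fun uv. Qed.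

Definition maps (g : homeo cantor_space) u v := forall w, g (prepend u w) = prepend v w.

Lemma maps1 u : maps 1%g u u.
Proof. by []. Qed.

Lemma mapsM g h u v x : maps g u v -> maps h v x -> maps (g * h)%g u x.
Proof. by move=> gu hv w; rewrite -hv -gu. Qed.

Lemma mapsV g u v : maps g u v -> maps g^-1%g v u.
Proof. by move=> gu w; rewrite -gu; exact: homeoK. Qed.

Lemma maps_cat g u v x : maps g u v -> maps g (u ++ x) (v ++ x).
Proof. by move=> gu w; rewrite !prepend_cat. Qed.

(** Since g is bijective, nothing outside the cone of u can land in the cone of v. *)
Lemma maps_starts g u v p : maps g u v -> starts v (g p) = starts u p.
Proof.
move=> gu; apply/idP/idP => [/startsP gp|/startsP <-]; last by rewrite gu starts_prependT.
by rewrite -(homeoK g p) -gp -gu homeoK starts_prependT.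
Qed.

Lemma maps_incomparable g u v u' v' : maps g u u' -> maps g v v' ->
  incomparable u' v' = incomparable u v.
Proof.
move=> gu gv; apply/incomparableP/incomparableP => disj p.
  by rewrite -(maps_starts _ gu) -(maps_starts _ gv); exact: disj.
by rewrite -(homeo_invK g p) (maps_starts _ gu) (maps_starts _ gv); exact: disj.
Qed.

(** This is the conjugation of (u v) by h, written without an inverse. If u and v are comparable, so
    are their images, and both swaps are trivial. *)
Lemma swap_conj h u v u' v' : maps h u u' -> maps h v v' ->
  (swap u v * h = h * swap u' v')%g.
Proof.
move=> hu hv; apply: homeo_ext => p /=; rewrite /swap_fun (maps_incomparable hu hv).
case: (incomparable u v) => //=; rewrite (maps_starts _ hu) (maps_starts _ hv).
case: ifP => [/startsP up|_]; first by rewrite hv -[X in h X]up hu tail_prepend.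
by case: ifP => [/startsP vp|//]; rewrite hu -[X in h X]vp hv tail_prepend.
Qed.

Lemma incomparable_cat u v x y : incomparable u v -> incomparable (u ++ x) (v ++ y).
Proof.
move=> /incomparableP uv; apply/incomparableP => p; rewrite !starts_cat.
by move=> /andP[/uv /negPf-> _].
Qed.

Lemma maps_swapl u v : incomparable u v -> maps (swap u v) u v.
Proof. by move=> uv w /=; rewrite /swap_fun uv /= starts_prependT tail_prepend. Qed.

Lemma maps_swapr u v : incomparable u v -> maps (swap u v) v u.
Proof. by rewrite swapC incomparableC; exact: maps_swapl. Qed.

Lemma maps_swap_fixed u v x : incomparable u x -> incomparable v x -> maps (swap u v) x x.
Proof.
rewrite ![incomparable _ x]incomparableC => xu xv w /=; rewrite /swap_fun.
case: ifP => // _.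
by rewrite !(incomparable_starts _ (starts_prependT x w)).
Qed.

(** Two homeomorphisms are compared cone by cone; the cover may depend on the point, so no basis has
    to be exhibited. *)
Lemma homeo_eq_maps (g h : homeo cantor_space) :
  (forall p, exists x y, [/\ starts x p, maps g x y & maps h x y]) -> g = h.
Proof.
move=> gh; apply: homeo_ext => p; have [x [y [/startsP <- gx hx]]] := gh p.
by rewrite gx hx.
Qed.

Lemma starts_next x p : starts x p -> starts (rcons x (p (size x))) p.
Proof.
by move=> xp; rewrite -cats1 starts_cat xp; apply/eqP; rewrite /mkseq /= /tail addn0.
Qed.

Lemma swap_split u v : incomparable u v ->
  swap u v = (swap (rcons u false) (rcons v false) * swap (rcons u true) (rcons v true))%g.
Proof.
move=> uv; rewrite -!cats1; apply: homeo_eq_maps => p.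
have vu : incomparable v u by rewrite incomparableC.
have bit_incomparable x b : incomparable (x ++ [:: b]) (x ++ [:: ~~ b]).
  by rewrite /incomparable !prefix_catr // eqxx; case: b.
have swap_bits x y b : incomparable x y -> maps (swap (x ++ [:: false]) (y ++ [:: false])
    * swap (x ++ [:: true]) (y ++ [:: true]))%g (x ++ [:: b]) (y ++ [:: b]).
  move=> xy; have yx : incomparable y x by rewrite incomparableC.
  case: b.
    apply: mapsM (maps_swapl (incomparable_cat _ _ xy)).
    apply: maps_swap_fixed; first exact: (bit_incomparable x false).
    exact: incomparable_cat.
  apply: mapsM (maps_swapl (incomparable_cat _ _ xy)) _.
  by apply: maps_swap_fixed; [exact: incomparable_cat | exact: (bit_incomparable y true)].
case up: (starts u p).
  exists (u ++ [:: p (size u)]), (v ++ [:: p (size u)]); split.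
  - by rewrite cats1 starts_next.
  - exact/maps_cat/maps_swapl.
  - exact: swap_bits.
case vp: (starts v p).
  exists (v ++ [:: p (size v)]), (u ++ [:: p (size v)]); split.
  - by rewrite cats1 starts_next.
  - exact/maps_cat/maps_swapr.
  - by rewrite swapC [X in (_ * X)%g]swapC; exact: swap_bits.
(* The point p lies in neither cone, so a prefix of p at least as long as u and v is incomparable
   with both, and its cone is fixed by all three swaps. *)
pose x := mkseq p (size u + size v).
have xp : starts x p by rewrite /starts /x size_mkseq.
have inc y : starts y p = false -> size y <= size u + size v -> incomparable y x.
  move=> yp ys; apply/incomparableP => q yq; apply/negP => xq.
  by rewrite (starts_prefix (starts_comparable yq xq _)) ?size_mkseq in yp.
have ux : incomparable u x by rewrite inc // leq_addr.
have vx : incomparable v x by rewrite inc // leq_addl.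
exists x, x; split=> //; first exact: maps_swap_fixed.
by rewrite -[x]cats0; apply: mapsM; apply: maps_swap_fixed; exact: incomparable_cat.
Qed.

(** * Words acted on by products of swaps *)

(** The result is [None] exactly when x is a proper prefix of one of the two words and of neither an
    extension: the swap then cuts the cone of x. *)
Definition swap_word (p : seq bool * seq bool) (x : seq bool) : option (seq bool) :=
  if prefix p.1 x then Some (p.2 ++ drop (size p.1) x)
  else if prefix p.2 x then Some (p.1 ++ drop (size p.2) x)
  else if prefix x p.1 || prefix x p.2 then None else Some x.

Lemma swap_word_maps p x y : incomparable p.1 p.2 ->
  swap_word p x = Some y -> maps (swap p.1 p.2) x y.
Proof.
move=> inc; rewrite /swap_word; case: ifP => [/prefixP[z ->] [<-]|p1x].
  by rewrite drop_size_cat //; apply/maps_cat/maps_swapl.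
case: ifP => [/prefixP[z ->] [<-]|p2x].
  by rewrite drop_size_cat //; apply/maps_cat/maps_swapr.
case: ifP => // /norP[xp1 xp2] [<-].
by apply: maps_swap_fixed; rewrite /incomparable ?p1x ?p2x.
Qed.

Definition swap_prod (l : seq (seq bool * seq bool)) : homeo cantor_space :=
  foldr (fun p g => swap p.1 p.2 * g)%g 1%g l.

(* [None] when some factor of the product cuts the cone it receives into pieces. *)
Definition act_word (l : seq (seq bool * seq bool)) (x : seq bool) : option (seq bool) :=
  foldl (fun ox p => obind (swap_word p) ox) (Some x) l.

Definition incomparable_pairs (l : seq (seq bool * seq bool)) :=
  all (fun p => incomparable p.1 p.2) l.

Lemma act_word_maps l x y : incomparable_pairs l -> act_word l x = Some y ->
  maps (swap_prod l) x y.
Proof.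
elim: l x => [|p l IH] x /=; first by move=> _ [<-].
case/andP=> inc prl; rewrite /act_word /=; case E: (swap_word p x) => [z|].
  by move=> Ey; exact: mapsM (swap_word_maps inc E) (IH _ prl Ey).
by have -> : foldl (fun ox p => obind (swap_word p) ox) None l = None by elim: (l).
Qed.

Lemma swap_prod_cat l1 l2 : swap_prod (l1 ++ l2) = (swap_prod l1 * swap_prod l2)%g.
Proof. by elim: l1 => [|p l IH]; rewrite ?mul1g //= IH mulgA. Qed.

Lemma swap_prod_rev l : swap_prod (rev l) = (swap_prod l)^-1%g.
Proof.
elim: l => [|p l IH]; first by rewrite invg1.
by rewrite rev_cons -cats1 swap_prod_cat IH /= mulg1 invgM swapV.
Qed.

Fixpoint words n : seq (seq bool) :=
  if n is n'.+1 then map (cons false) (words n') ++ map (cons true) (words n')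
  else [:: [::]].

Lemma mem_words n x : (x \in words n) = (size x == n).
Proof.
elim: n x => [|n IH] [|b x] //=; rewrite mem_cat.
  by apply/negP => /orP[] /mapP[].
rewrite eqSS -IH; apply/orP/idP => [[] /mapP[y yn [_ ->]] //|xn].
by case: b; [right|left]; apply: map_f.
Qed.

Lemma words_uniq n : uniq (words n).
Proof.
elim: n => //= n IH; rewrite cat_uniq !map_inj_uniq ?IH /=; try by move=> x y [].
by rewrite andbT; apply/hasPn => _ /mapP[x _ ->]; apply/negP => /mapP[].
Qed.

(* [if] rather than [&&] and [||], which [vm_compute] evaluates strictly. *)
Fixpoint agree n l1 l2 x : bool :=
  if act_word l1 x is Some y then act_word l2 x == Some y
  else if n is n'.+1 then
    if agree n' l1 l2 (rcons x false) then agree n' l1 l2 (rcons x true) else false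
  else false.

(** Equality is decided by computation: [agree] bisects cones, at most n times, until both products
    replace the prefix in the same way. The proof follows the letters of p down this binary tree to
    a leaf. *)
Lemma swap_prod_eq n l1 l2 : incomparable_pairs l1 -> incomparable_pairs l2 ->
  agree n l1 l2 [::] -> swap_prod l1 = swap_prod l2.
Proof.
move=> ok1 ok2 agr; apply: homeo_eq_maps => p.
have : starts [::] p by [].
elim: n [::] agr => [|n IH] x /=; case E1: act_word => [y|//].
1,2: by move=> /eqP E2 xp; exists x, y; split=> //; exact: act_word_maps.
case: ifP => // x0 x1 xp.
by case: (p (size x)) (starts_next xp) => ?; [exact: IH x1 _ | exact: IH x0 _].
Qed.

(** * Reduction of all swaps to short ones *)

Section SubgroupMembership.
Variables (G : groupType) (H : set G).
Hypothesis HG : group_closed (mem H).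

Lemma group_mem1 : H 1%g.
Proof. by case: HG => + _; rewrite inE. Qed.

Lemma group_memM g h : H g -> H h -> H (g * h)%g.
Proof. by have /(_ g h) := group_closedM HG; rewrite !inE => HM Hg; exact: HM. Qed.

Lemma group_memV g : H g -> H g^-1%g.
Proof. by have /(_ g) := group_closedV HG; rewrite !inE. Qed.

End SubgroupMembership.

Section GeneratedSwaps.
Variable H : set (homeo cantor_space).
Hypothesis HG : group_closed (mem H).

Lemma group_mem_conj h u v u' v' : maps h u u' -> maps h v v' ->
  H h -> H (swap u v) -> H (swap u' v').
Proof.
move=> hu hv Hh Huv.
have -> : swap u' v' = (h^-1 * (swap u v * h))%g by rewrite (swap_conj hu hv) mulKg.
by apply: (group_memM HG); [exact: (group_memV HG) | exact: (group_memM HG)].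
Qed.

Lemma group_mem_split u v : H (swap (rcons u false) (rcons v false)) ->
  H (swap (rcons u true) (rcons v true)) -> H (swap u v).
Proof.
move=> H0 H1; case uv: (incomparable u v).
  by rewrite swap_split //; exact: (group_memM HG).
by rewrite swap_comparable ?uv //; exact: (group_mem1 HG).
Qed.

Hypothesis short_swaps : forall x y, size x \in [:: 2; 3] -> size y = 2 ->
  incomparable x y -> H (swap x y).

(** Of the four words of length 2, at most two are excluded by the first two letters of x and of
    v. *)
Lemma exists_free_word2 (x v : seq bool) : 1 < size x -> 1 < size v ->
  exists y, [/\ size y = 2, incomparable x y & incomparable y v].
Proof.
case: x v => [|a [|b x]] //= [|c [|d v]] //= _ _.
have [y] : exists2 y, y \in words 2 & (y != [:: a; b]) && (y != [:: c; d]).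
  by apply/hasP; case: a b c d => [] [] [] [].
rewrite mem_words; case: y => [|e [|f []]] //= _; rewrite !eqseq_cons !andbT => yne.
exists [:: e; f]; split=> //; rewrite /incomparable /= !prefix0s ?andbT.
  by move: yne; case: a b e f c d => [] [] [] [] [] [].
by move: yne; case: a b e f c d => [] [] [] [] [] [].
Qed.

(* Conjugation by (x y), where x consists of the first three letters of u and |y| = 2 with
   y incomparable to x and v, shortens u and does not lengthen v. *)
Lemma all_long_swaps u v : 1 < size u -> 1 < size v -> incomparable u v -> H (swap u v).
Proof.
have [n] := ubnP (size u + size v); elim: n u v => // n IH u v le_n.
(* If both words have length 2, the swap is a short one; otherwise the symmetry of the swap lets u
   be a word of length at least 3. *)
wlog u3 : u v le_n / 2 < size u => [hw|] u2 v2 uv.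
  case: (ltnP 2 (size u)) => [?|u2']; first exact: hw le_n _ u2 v2 uv.
  case: (ltnP 2 (size v)) => [v3|v2']; last first.
    apply: short_swaps uv; first by rewrite !inE eqn_leq u2' u2.
    by apply/eqP; rewrite eqn_leq v2' v2.
  by rewrite swapC; apply: hw; rewrite // 1?addnC // incomparableC.
have eu := cat_take_drop 3 u; set x := take 3 u in eu.
have sx : size x = 3 by rewrite size_takel.
have [y [sy xy yv]] : exists y, [/\ size y = 2, incomparable x y & incomparable y v].
  by apply: exists_free_word2; rewrite ?sx.
have Hxy : H (swap x y) by apply: short_swaps; rewrite ?sx.
pose u' := y ++ drop 3 u.
have u'u : maps (swap x y) u' u by rewrite -[X in maps _ _ X]eu; apply/maps_cat/maps_swapr.
have su' : size u' < size u by rewrite size_cat sy size_drop; move: u3; clear; lia.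
have [v' [v'v sv' v'2]] : exists v',
    [/\ maps (swap x y) v' v, size v' <= size v & 1 < size v'].
  case xv: (prefix x v).
    have /prefixP[z ev] := xv; exists (y ++ z); split.
    - by rewrite ev; apply/maps_cat/maps_swapr.
    - by rewrite ev !size_cat sy sx leq_add2r.
    - by rewrite size_cat sy.
  (* Here v is fixed: it is incomparable with y by the choice of y, and a prefix of x would be a
     prefix of u. *)
  exists v; split=> //; apply: maps_swap_fixed => //.
  rewrite /incomparable xv /=; apply/negP => vx; case/andP: uv => _ /negP[].
  by rewrite -eu; exact: prefix_catl.
apply: (group_mem_conj u'u v'v Hxy); apply: IH => //.
- by move: su' sv' le_n; clear; lia.
- by rewrite size_cat sy.
- by rewrite -(maps_incomparable u'u v'v).
Qed.

(** Incomparable words are nonempty, so one splitting makes all the words involved have length at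
    least 2. *)
Lemma all_swaps u v : H (swap u v).
Proof.
case uv: (incomparable u v); last by rewrite swap_comparable ?uv //; exact: (group_mem1 HG).
have nonempty x y : incomparable x y -> 0 < size x.
  by case: x => //; rewrite /incomparable prefix0s.
have su := nonempty _ _ uv; have sv : 0 < size v by rewrite (nonempty v u) // incomparableC.
have inc b : incomparable (rcons u b) (rcons v b) by rewrite -!cats1 incomparable_cat.
by apply: group_mem_split; apply: all_long_swaps; rewrite ?size_rcons ?ltnS.
Qed.

End GeneratedSwaps.

(** * Bases and tables *)

(* Counting to one says at once that the cones cover the space and are disjoint. *)
Definition complete (s : seq (seq bool)) := forall p, count (starts^~ p) s = 1.

(** Only the first column is asked to be a basis; [complete_image] derives the same for the second
    from the bijectivity of g. *)
Definition table (g : homeo cantor_space) (s : seq (seq bool * seq bool)) :=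
  complete (map fst s) /\ {in s, forall x, maps g x.1 x.2}.

Lemma complete_inj s u v p : complete s -> u \in s -> v \in s ->
  starts u p -> starts v p -> u = v.
Proof.
move=> /(_ p); rewrite -size_filter => sz us vs up vp.
have : u \in seq.filter (starts^~ p) s by rewrite mem_filter up.
have : v \in seq.filter (starts^~ p) s by rewrite mem_filter vp.
by case: (seq.filter _ s) sz => [|x []] //= _; rewrite !inE => /eqP-> /eqP->.
Qed.

Lemma complete_cover s p : complete s -> exists2 u, u \in s & starts u p.
Proof. by move=> /(_ p) c1; apply/hasP; rewrite has_count c1. Qed.

Lemma complete_incomparable s u v : complete s -> u \in s -> v \in s -> u != v ->
  incomparable u v.
Proof.
move=> cs us vs uv; apply/incomparableP => p up; apply: contra uv => vp.
exact/eqP/(complete_inj cs us vs up vp).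
Qed.

(** A word listed twice would be counted twice at each point of its cone. *)
Lemma complete_uniq s : complete s -> uniq s.
Proof.
move=> cs; apply: count_mem_uniq => x; case xs: (x \in s); last exact/count_memPn/negbT.
apply/eqP; rewrite -[nat_of_bool true]/1 eqn_leq -has_count has_pred1 xs andbT.
rewrite -(cs (prepend x point)); apply: sub_count => y /eqP->.
exact: starts_prependT.
Qed.

Lemma complete_nil s : complete s -> [::] \in s -> s = [:: [::]].
Proof.
move=> cs s0; have us := complete_uniq cs.
apply: perm_small_eq => //; rewrite uniq_perm // => x; rewrite inE.
apply/idP/eqP => [xs|->//].
exact: (complete_inj cs xs s0 (starts_prependT x point)).
Qed.

Lemma complete_single v : complete [:: v] -> v = [::].
Proof.
case: v => // b v /(_ (prepend [:: ~~ b] point)) /=.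
by rewrite -cat1s starts_cat starts_prepend //= eq_sym; case: b.
Qed.

(** Take a longest word. The word of s that covers its sibling is no longer, hence a prefix of the
    sibling; a proper prefix would also be a proper prefix of the longest word, against
    disjointness. *)
Lemma complete_siblings s : complete s -> s != [:: [::]] ->
  exists u, rcons u false \in s /\ rcons u true \in s.
Proof.
move=> cs sn; have [x0 x0s _] := complete_cover point cs.
have [u us umax] : exists2 u, u \in s & forall v, v \in s -> size v <= size u.
  have exP : exists n, has (fun v => size v == n) s.
    by exists (size x0); apply/hasP; exists x0.
  have ubP n : has (fun v => size v == n) s -> n <= \max_(v <- s) size v.
    by move=> /hasP[v vs /eqP<-]; rewrite (big_rem v) //= leq_maxl.
  case: (ex_maxnP exP ubP) => n /hasP[v vs /eqP ev] vmax.
  by exists v => // w ws; rewrite ev; apply: vmax; apply/hasP; exists w.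
case/lastP: u => [|t b] in us umax *.
  by rewrite (complete_nil cs us) eqxx in sn.
suff tb : rcons t (~~ b) \in s by exists t; case: b us tb {umax}.
have [v vs] := complete_cover (prepend (rcons t (~~ b)) point) cs.
rewrite starts_prepend; last by rewrite (leq_trans (umax _ vs)) // !size_rcons.
case/prefixP=> x; case/lastP: x => [|x c]; first by rewrite cats0 => ->.
rewrite -rcons_cat => /rcons_inj[et _].
have := complete_inj cs vs us _ (starts_prependT (rcons t b) point).
rewrite -cats1 et -catA prepend_cat starts_prependT => /(_ isT) ev.
by move/(congr1 size): ev; rewrite !size_cat /=; lia.
Qed.

Lemma complete_image g s : table g s -> complete (map snd s).
Proof.
move=> [cs gs] q; rewrite -(cs ((g^-1)%g q)) !count_map; apply: eq_in_count => x xs /=.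
by rewrite -(maps_starts _ (gs x xs)) /= homeo_invK.
Qed.

Lemma table_inv g s : table g s -> table g^-1%g [seq (x.2, x.1) | x <- s].
Proof.
move=> ts; split; last by move=> _ /mapP[x xs ->]; apply/mapsV/ts.2.
by rewrite -map_comp; exact: complete_image ts.
Qed.

Lemma table_single g v : table g [:: ([::], v)] -> g = 1%g.
Proof.
move=> tg; have v0 := complete_single (complete_image tg); apply: homeo_ext => p.
by have := tg.2 ([::], v) (mem_head _ _) p; rewrite v0 /= prepend0.
Qed.

Definition exchange (a b x : seq bool) := if x == a then b else if x == b then a else x.

Lemma exchangeK a b : involutive (exchange a b).
Proof.
move=> x; rewrite /exchange; case: (eqVneq x a) => [->|xa].
  by rewrite eqxx; case: eqVneq.
case: (eqVneq x b) => [->|xb]; first by rewrite eqxx.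
by rewrite (negPf xa) (negPf xb).
Qed.

Lemma exchange_mem a b x (t : seq (seq bool)) :
  a \in t -> b \in t -> x \in t -> exchange a b x \in t.
Proof. by move=> at_ bt xt; rewrite /exchange; case: ifP => // _; case: ifP. Qed.

(** The words of a basis are pairwise incomparable, so the swap of two of them moves or fixes each
    of them as a whole. *)
Lemma table_swap g s a b : table g s -> a \in map snd s -> b \in map snd s ->
  table (g * swap a b)%g [seq (x.1, exchange a b x.2) | x <- s].
Proof.
move=> tg az bz; have cz := complete_image tg; split.
  by rewrite -map_comp; exact: tg.1.
move=> _ /mapP[x xs ->] /=; apply: mapsM (tg.2 x xs) _.
have xz : x.2 \in map snd s by exact: map_f.
rewrite /exchange; case: eqVneq => [->|xa].
  case: (eqVneq a b) => [->|ab].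
    by rewrite swap_comparable // /incomparable prefix_refl.
  exact/maps_swapl/(complete_incomparable cz).
case: eqVneq => [eb|xb].
  by rewrite eb in xa *; apply/maps_swapr/(complete_incomparable cz); rewrite // eq_sym.
by apply: maps_swap_fixed; apply: (complete_incomparable cz); rewrite // eq_sym.
Qed.

Lemma maps_merge g u v : (forall b, maps g (rcons u b) (rcons v b)) -> maps g u v.
Proof.
move=> gb w; have ew : w = prepend [:: w 0] (tail 1 w) by symmetry; apply/startsP/eqP.
by rewrite ew -!prepend_cat !cats1; exact: gb.
Qed.

Lemma table_merge g s u v : table g s ->
  (forall b, (rcons u b, rcons v b) \in s) ->
  exists2 s', table g s' & size s' < size s.
Proof.
move=> tg uvs; have us := map_uniq (complete_uniq tg.1).
pose x b := (rcons u b, rcons v b).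
(* The two entries are distinct and s has no repetition, so both can be brought to the front. *)
have [s' ps] : exists s', perm_eq s [:: x false, x true & s'].
  have := perm_to_rem (uvs false) => p0.
  have x1 : x true \in rem (x false) s.
    rewrite (mem_rem_uniq _ us) inE uvs andbT /x xpair_eqE.
    by apply/negP => /andP[/eqP/rcons_inj[]].
  by exists (rem (x true) (rem (x false) s)); rewrite (permPl p0) perm_cons perm_to_rem.
exists ((u, v) :: s'); last by rewrite (perm_size ps).
split.
  move=> p; rewrite -(tg.1 p) (permP (perm_map fst ps)) /= addnA; congr (_ + _).
  rewrite -!cats1 !starts_cat /starts /=.
  by case: eqP => //= _; rewrite /mkseq /=; case: (tail _ _ _).
move=> y; rewrite inE => /predU1P[->|ys].
  by apply: maps_merge => b; exact: (tg.2 (x b) (uvs b)).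
by apply: tg.2; rewrite (perm_mem ps) !inE ys !orbT.
Qed.

(** * Generation by swaps *)

Section Generation.
Variable H : set (homeo cantor_space).
Hypothesis HG : group_closed (mem H).
Hypothesis Hswap : forall u v, H (swap u v).

Lemma table_generated g s : table g s -> H g.
Proof.
have [n] := ubnP (size s); elim: n g s => // n IH g s; rewrite ltnS => le_n tg.
have cz := complete_image tg.
case: (eqVneq (map fst s) [:: [::]]) => [s1|s1].
  case: s s1 tg {le_n cz} => [|[x v] []] //= [->] /table_single ->.
  exact: (group_mem1 HG).
have [u [u0 u1]] := complete_siblings tg.1 s1.
(* The two columns have the same length, and the first contains two distinct siblings. *)
have z1 : map snd s != [:: [::]].
  have ss : 1 < size s.
    rewrite -(size_map fst).
    apply: (@uniq_leq_size _ [:: rcons u false; rcons u true]) => [|w] /=.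
      by rewrite inE andbT; apply/eqP => /rcons_inj[].
    by rewrite !inE => /orP[]/eqP->.
  by apply: contraTneq ss => /(congr1 size); rewrite size_map => ->.
have [v [v0 v1]] := complete_siblings cz z1.
case/mapP: u0 => -[x0 a0] a0s /= ?; subst x0.
case/mapP: u1 => -[x1 a1] a1s /= ?; subst x1.
have a0z : a0 \in map snd s by apply/mapP; exists (rcons u false, a0).
(* The first swap makes u0 go to v0; [b1] is then the new image of u1, and the second swap will
   bring it to v1. *)
have tg1 := table_swap tg a0z v0.
set s1' := [seq (x.1, _) | x <- s] in tg1.
pose b1 := exchange a0 (rcons v false) a1.
have b1s : (rcons u true, b1) \in s1' by apply/mapP; exists (rcons u true, a1).
have w0s : (rcons u false, rcons v false) \in s1'.
  by apply/mapP; exists (rcons u false, a0); rewrite //= /exchange eqxx.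
have b1z : b1 \in map snd s1' by apply/mapP; exists (rcons u true, b1).
have v1z : rcons v true \in map snd s1'.
  rewrite -map_comp -[rcons v true](exchangeK a0 (rcons v false)).
  rewrite (map_comp (exchange _ _) snd) map_f //; exact: exchange_mem.
have tg2 := table_swap tg1 b1z v1z.
set s2 := [seq (x.1, _) | x <- s1'] in tg2.
have rcons_neq x : rcons x false != rcons x true by apply/eqP => /rcons_inj[].
(* The images of u0 and u1 remain distinct, so the second swap leaves v0 in place. *)
have v0b1 : rcons v false != b1.
  apply/eqP => e; have := complete_incomparable (complete_image tg1) b1z b1z.
  have := maps_incomparable (tg1.2 _ w0s) (tg1.2 _ b1s); rewrite /= -e.
  rewrite (complete_incomparable tg.1 (map_f fst a0s) (map_f fst a1s) (rcons_neq u)).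
  by rewrite /incomparable prefix_refl.
have [b|s3 tg3 lt3] := @table_merge _ s2 u v tg2.
- case: b; apply/mapP.
    by exists (rcons u true, b1); rewrite //= /exchange eqxx.
  exists (rcons u false, rcons v false); rewrite //= /exchange.
  by rewrite (negPf v0b1) (negPf (rcons_neq v)).
have := IH _ s3 _ tg3; rewrite !size_map in lt3; move=> /(_ (leq_trans lt3 le_n)) Hg.
(* Undoing the two swaps in reverse order recovers g from the element with the shorter table. *)
have -> : g = (g * swap a0 (rcons v false) * swap b1 (rcons v true)
    * swap b1 (rcons v true) * swap a0 (rcons v false))%g.
  by rewrite -!mulgA [X in (_ * (_ * X))%g]mulgA swapK mul1g swapK mulg1.
by do 2 (apply: (group_memM HG) => //).
Qed.
End Generation.

(** * Tables and membership in V *)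

Definition local_map g := exists N, forall x, N <= size x -> exists y, maps g x y.

Lemma table_local g s : table g s -> local_map g.
Proof.
move=> tg; exists (\max_(x <- s) size x.1) => z Nz.
have [_ /mapP[x xs ->]] := complete_cover (prepend z point) tg.1.
rewrite starts_prepend => [/prefixP[t ->]|].
  by exists (x.2 ++ t); apply/maps_cat/tg.2.
by rewrite (leq_trans _ Nz) // (big_rem x) //= leq_maxl.
Qed.

Lemma complete_words n : complete (words n).
Proof.
move=> p; rewrite (@eq_in_count _ _ (pred1 (mkseq p n))).
  by rewrite count_uniq_mem ?words_uniq // mem_words size_mkseq eqxx.
by move=> x; rewrite mem_words /starts => /eqP->.
Qed.

(** All words of length N form a basis, and each of them is mapped to some word. *)
Lemma local_table g : local_map g -> exists s, table g s.
Proof.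
move=> [N gN]; have /choice[f fP] : forall x, exists y, N <= size x -> maps g x y.
  by move=> x; case: (leqP N (size x)) => [/gN[y gy]|]; [exists y|exists x].
exists [seq (x, f x) | x <- words N]; split.
  by rewrite -map_comp map_id; exact: complete_words.
by move=> _ /mapP[x xN ->]; apply: fP; move: xN; rewrite mem_words => /eqP->.
Qed.

(** In a word of length at least N + M, g rewrites the first N letters and leaves at least M behind,
    so the image is long enough for h however short the new prefix is. *)
Lemma local_mapM g h : local_map g -> local_map h -> local_map (g * h)%g.
Proof.
move=> [N gN] [M hM]; exists (N + M) => x Nx.
have [|y gy] := gN (take N x); first by rewrite size_takel // (leq_trans (leq_addr _ _) Nx).
have [|z hz] := hM (y ++ drop N x); first by rewrite size_cat size_drop; lia.
by exists z; apply: mapsM hz; rewrite -[x in maps _ x _](cat_take_drop N); exact: maps_cat.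
Qed.

(** A word at least as long as u and v is a proper prefix of neither, so the swap does not cut its
    cone. *)
Lemma local_map_swap u v : local_map (swap u v).
Proof.
case uv: (incomparable u v); last first.
  by exists 0 => x _; exists x; rewrite swap_comparable ?uv.
exists (maxn (size u) (size v)) => x; rewrite geq_max => /andP[ux vx].
have := @swap_word_maps (u, v) x _ uv; rewrite /swap_word /=.
case: ifP => [_|ux']; first by exists (v ++ drop (size u) x); auto.
case: ifP => [_|vx']; first by exists (u ++ drop (size v) x); auto.
case: ifP => [|_]; last by exists x; auto.
have prefix_long y : size y <= size x -> prefix x y -> prefix y x.
  move=> yx /prefixP[[|b t] ey]; first by rewrite ey cats0 prefix_refl.
  by move: yx; rewrite ey size_cat /=; lia.
by case/orP=> /prefix_long; rewrite ?ux' ?vx' => /(_ ltac:(done)).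
Qed.

Lemma complete_basis s : complete s -> cantor_basis [set` s].
Proof.
move=> cs; split; first exact: finite_seq.
split.
- apply/seteqP; split=> // p _; have [u us /startsP <-] := complete_cover p cs.
  by exists (cone u); [exists u|eexists].
- move=> _ _ [u us <-] [v vs <-] [p [[w _ wp] [w' _ wp']]]; congr cone.
  apply: (complete_inj (p := p) cs us vs); last rewrite -wp'; last exact: starts_prependT.
  by rewrite -wp starts_prependT.
- by move=> _ [u _ <-]; exists (prepend u point); exists point.
Qed.

Lemma cone_starts u p : cone u p <-> starts u p.
Proof.
by split=> [[w _ <-]|/startsP up]; [exact: starts_prependT | exists (tail (size u) p)].
Qed.

(** If v extends u by a letter b and more, the point that continues u with the opposite letter only
    is in the cone of u and not in that of v. *)
Lemma cone_inj : injective cone.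
Proof.
move=> u v; wlog uv : u v / size u <= size v => [hw|] euv.
  by case: (leqP (size u) (size v)) => [|/ltnW] /hw; [apply|move=> /(_ (esym euv))].
have /cone_starts : cone u (prepend v point) by rewrite euv; exists point.
rewrite starts_prepend // => /prefixP[[|b t] ev]; first by rewrite ev cats0.
have /cone_starts : cone v (prepend u (fun=> ~~ b)) by rewrite -euv; exists (fun=> ~~ b).
rewrite ev starts_cat starts_prependT tail_prepend => /andP[_ /eqP] [] /esym.
by case: b {ev}.
Qed.

(** The partition consists of cones, not of words; [cone_inj] passes from one to the other. The
    enumeration of A may repeat words, hence [undup]. *)
Lemma basis_complete A : cantor_basis A -> exists2 s, complete s & A = [set` s].
Proof.
move=> [/finite_seqP[s ->] [cov triv _]]; exists (undup s); last first.
  by apply/seteqP; split=> x /=; rewrite mem_undup.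
move=> p; have : [set: cantor_space] p by [].
rewrite -cov => -[_ [u us <-]] [w _ wp].
have up : starts u p by rewrite -wp; exact: starts_prependT.
rewrite (@eq_in_count _ _ (pred1 u)).
  by rewrite count_uniq_mem ?undup_uniq // mem_undup us.
move=> v; rewrite mem_undup => vs /=; apply/idP/eqP => [vp|->//].
apply: cone_inj; apply: triv; [by exists v|by exists u|exists p; split; last by exists w].
exact/cone_starts.
Qed.

Lemma thompsonV_table g : thompsonV g <-> exists s, table g s.
Proof.
split=> [[A [B [f [/basis_complete[s cs eA] _ _ fP]]]]|[s tg]].
  exists [seq (u, f u) | u <- s]; split; first by rewrite -map_comp map_id.
  by move=> _ /mapP[u us ->] w; apply: fP; rewrite eA.
(* The bijection must be a total function on words; its values outside the first column are
   arbitrary. *)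
have /choice[f fP] : forall u, exists v, u \in map fst s -> (u, v) \in s.
  move=> u; case us: (u \in map fst s); last by exists u.
  by case/mapP: us => -[x v] xs ->; exists v.
have cz := complete_image tg.
have snd_mem x : x \in s -> x.2 \in map snd s by exact: map_f.
have fE x : x \in s -> f x.1 = x.2.
  move=> xs; have fs := fP _ (map_f fst xs).
  apply: (complete_inj (p := g (prepend x.1 point)) cz); rewrite ?snd_mem //.
  - exact: snd_mem fs.
  - by rewrite (maps_starts _ (tg.2 _ fs)) starts_prependT.
  - by rewrite (maps_starts _ (tg.2 _ xs)) starts_prependT.
exists [set` map fst s], [set` map snd s], f; split.
- exact/complete_basis/tg.1.
- exact: complete_basis.
- split.
  + by move=> u /= us; exact: snd_mem (fP _ us).
  + move=> u v; rewrite !inE /= => us vs fuv.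
    apply: (complete_inj (p := prepend u point) tg.1 us vs); first exact: starts_prependT.
    rewrite -(maps_starts _ (tg.2 _ (fP _ vs))) /= -fuv.
    by rewrite (maps_starts _ (tg.2 _ (fP _ us))) starts_prependT.
  + by move=> _ /= /mapP[x xs ->]; exists x.1; [exact: map_f|exact: fE].
- by move=> u w /= us; exact: (tg.2 _ (fP _ us)).
Qed.

Lemma thompsonV_group : group_closed (mem thompsonV).
Proof.
split.
  rewrite inE; apply/thompsonV_table; exists [:: ([::], [::])]; split=> // x.
  by rewrite inE => /eqP->.
(* Closure is stated for quotients, so the table of the second element is inverted. *)
move=> g h; rewrite !inE => /thompsonV_table[s /table_local gs].
move=> /thompsonV_table[t /table_inv /table_local hs].
exact/thompsonV_table/local_table/local_mapM.
Qed.

Lemma thompsonV_swap u v : thompsonV (swap u v).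
Proof. exact/thompsonV_table/local_table/local_map_swap. Qed.

(** * The two generators *)

Fixpoint word (s : String.string) : seq bool :=
  if s is String.String c s' then Ascii.eqb c "1"%char :: word s' else [::].

Definition wordpairs : seq (String.string * String.string) -> seq (seq bool * seq bool) :=
  map (fun p => (word p.1, word p.2)).

Definition alpha_swaps := wordpairs [:: ("10", "11"); ("001", "0000")]%string.

(** With the action on the right, (a b)(a c) is the cycle a to b to c to a. *)
Definition beta_swaps :=
  wordpairs [:: ("0", "111"); ("0", "110"); ("1000", "1001"); ("1000", "101")]%string.

Definition betaV_swaps := rev beta_swaps.

Definition seed_period :=
  let ab := alpha_swaps ++ beta_swaps in let aB := alpha_swaps ++ betaV_swaps in
  ab ++ aB ++ ab ++ ab ++ aB ++ aB.

Definition seed_word := flatten (nseq 35 seed_period).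

Definition seed_swap := (word "100000", word "10001").

(* Listed so that each pair is [derivable] from the previous ones and [seed_swap]. *)
Definition derived_swaps := wordpairs [::
  ("10100", "1011"); ("11100", "1111"); ("11000", "1101"); ("10000", "1001");
  ("1000", "1010"); ("1100", "1110"); ("00", "1110"); ("10010", "101"); ("00", "1100");
  ("000", "1101"); ("000", "01"); ("01", "1101"); ("01", "1001"); ("010", "101");
  ("010", "111"); ("00", "0100"); ("00", "1010"); ("00", "1000"); ("01", "1111");
  ("01", "1011"); ("0", "101"); ("0", "110"); ("101", "110"); ("0", "1000");
  ("0", "10000"); ("0", "1001"); ("0", "100"); ("01", "100"); ("00", "100");
  ("00", "01"); ("00", "010"); ("001", "01"); ("00", "011"); ("00", "101");
  ("00", "110"); ("00", "111"); ("01", "110"); ("01", "111"); ("01", "101");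
  ("0", "10"); ("00", "10"); ("000", "10"); ("001", "10"); ("01", "10"); ("01", "11");
  ("010", "10"); ("010", "11"); ("011", "10"); ("011", "11"); ("10", "110");
  ("10", "111"); ("100", "11"); ("101", "11"); ("10", "11"); ("00", "11");
  ("000", "11"); ("001", "11")]%string.

Lemma seed_word_eq : swap_prod seed_word = swap seed_swap.1 seed_swap.2.
Proof.
have -> : swap seed_swap.1 seed_swap.2 = swap_prod [:: seed_swap] by rewrite /= mulg1.
(* Words of length at most 10 are enough to follow every cone through all the factors of
   [seed_word]. *)
by apply: (@swap_prod_eq 10); vm_compute.
Qed.

(** A known swap conjugates as a product with one factor. Of the generators only [beta_swaps] needs
    its inverse listed, as alpha is an involution. *)
Definition derivable (known : seq (seq bool * seq bool)) (q : seq bool * seq bool) :=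
  has (fun l => incomparable_pairs l && has (fun p =>
      if (act_word l p.1, act_word l p.2) is (Some u, Some v)
      then ((u, v) == q) || ((v, u) == q) else false) known)
    ([:: alpha_swaps; beta_swaps; betaV_swaps] ++ [seq [:: p] | p <- known])
  || all (fun b => (rcons q.1 b, rcons q.2 b) \in known) [:: false; true].

Fixpoint derivation known qs :=
  if qs is q :: qs' then derivable known q && derivation (q :: known) qs' else true.

Lemma derivation_complete :
  derivation [:: seed_swap] derived_swaps &&
  all (fun x => all (fun y => incomparable x y ==>
      ((x, y) \in derived_swaps) || ((y, x) \in derived_swaps)) (words 2))
    (words 2 ++ words 3).
Proof. by vm_compute. Qed.

Definition alpha := swap_prod alpha_swaps.
Definition beta := swap_prod beta_swaps.

Section Generators.
Variable H : set (homeo cantor_space).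
Hypotheses (HG : group_closed (mem H)) (Halpha : H alpha) (Hbeta : H beta).

Lemma derivable_mem known q :
  {in known, forall p, H (swap p.1 p.2)} -> derivable known q -> H (swap q.1 q.2).
Proof.
move=> Hknown /orP[/hasP[l lgen /andP[prl /hasP[p pk]]]|/and3P[q0 q1 _]]; last first.
  by apply: (group_mem_split HG); [exact: (Hknown _ q0) | exact: (Hknown _ q1)].
case E1: act_word => [u|//]; case E2: act_word => [v|//] quv.
have Hl : H (swap_prod l).
  move: lgen; rewrite mem_cat !inE => /orP[/or3P[]/eqP->|/mapP[r rk ->]] //.
    by rewrite swap_prod_rev; exact: (group_memV HG).
  by rewrite /= mulg1; exact: Hknown.
have Huv : H (swap u v).
  exact: (group_mem_conj HG (act_word_maps prl E1) (act_word_maps prl E2) Hl (Hknown _ pk)).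
by case/orP: quv => /eqP<- //; rewrite swapC.
Qed.

Lemma derivation_mem known qs : {in known, forall p, H (swap p.1 p.2)} ->
  derivation known qs -> {in qs, forall q, H (swap q.1 q.2)}.
Proof.
elim: qs known => //= q qs IH known Hknown /andP[/(derivable_mem Hknown) Hq].
move=> /IH Hqs r; rewrite inE => /predU1P[->//|]; apply: Hqs => p.
by rewrite inE => /predU1P[->//|]; exact: Hknown.
Qed.

Lemma seed_swap_mem : H (swap seed_swap.1 seed_swap.2).
Proof.
have Hperiod : H (swap_prod seed_period).
  rewrite !swap_prod_cat swap_prod_rev.
  by do ?[apply: (group_memM HG) => //]; exact: (group_memV HG).
(* The exponent 35 is generalized: every power of the period lies in H. *)
rewrite -seed_word_eq /seed_word; elim: 35 => [|n IH]; first exact: (group_mem1 HG).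
have -> : flatten (nseq n.+1 seed_period) =
    seed_period ++ flatten (nseq n seed_period) by [].
rewrite swap_prod_cat; exact: (group_memM HG).
Qed.

Lemma generated_swaps u v : H (swap u v).
Proof.
have /andP[der /allP cov] := derivation_complete.
apply: (all_swaps HG) => x y x23 y2 xy.
have Hder : {in derived_swaps, forall q, H (swap q.1 q.2)}.
  by apply: derivation_mem der => p; rewrite inE => /eqP->; exact: seed_swap_mem.
have xw : x \in words 2 ++ words 3 by move: x23; rewrite mem_cat !mem_words !inE.
have yw : y \in words 2 by rewrite mem_words y2.
have /implyP/(_ xy)/orP[] := allP (cov x xw) y yw; last rewrite swapC.
  exact: (Hder (x, y)).
exact: (Hder (y, x)).
Qed.

End Generators.

(** The product moves the cone of x to a cone disjoint from it. *)
Lemma swap_prod_neq1 l x y : incomparable_pairs l -> act_word l x = Some y ->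
  incomparable x y -> swap_prod l <> 1%g.
Proof.
move=> prl /(act_word_maps prl) lxy xy l1; rewrite {}l1 in lxy.
have := maps_incomparable lxy (maps1 x); rewrite incomparableC xy.
by rewrite /incomparable prefix_refl.
Qed.

Lemma alpha_order : has_order alpha 2.
Proof.
split; first exact: isT.
  rewrite expgS expg1 -swap_prod_cat.
  by apply: (@swap_prod_eq 5 _ [::]); vm_compute.
move=> m lt_m; have -> : m = 1 by lia.
by rewrite expg1; apply: (@swap_prod_neq1 _ (word "10") (word "11")); vm_compute.
Qed.

Lemma beta_order : has_order beta 3.
Proof.
have beta2 : (beta ^+ 2)%g = swap_prod (beta_swaps ++ beta_swaps).
  by rewrite swap_prod_cat expgS expg1.
split; first exact: isT.
  rewrite expgS beta2 -swap_prod_cat.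
  by apply: (@swap_prod_eq 5 _ [::]); vm_compute.
move=> m lt_m; have [->|->] : m = 1 \/ m = 2 by lia.
  by rewrite expg1; apply: (@swap_prod_neq1 _ (word "0") (word "111")); vm_compute.
by rewrite beta2; apply: (@swap_prod_neq1 _ (word "0") (word "110")); vm_compute.
Qed.

Lemma swap_prod_thompsonV l : thompsonV (swap_prod l).
Proof.
elim: l => [|p l IH] /=; first exact: (group_mem1 thompsonV_group).
exact: (group_memM thompsonV_group (thompsonV_swap _ _) IH).
Qed.

Theorem corollary2 :
  exists alpha beta : homeo cantor_space,
    [/\ thompsonV alpha, thompsonV beta, has_order alpha 2, has_order beta 3 &
        thompsonV = subgroup_generated [set alpha; beta]%classic].
Proof.
exists alpha, beta; split.
- exact: swap_prod_thompsonV.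
- exact: swap_prod_thompsonV.
- exact: alpha_order.
- exact: beta_order.
(* The generated subgroup is the intersection of all subgroups H containing the generators, so g is
   shown to lie in each such H. *)
apply/seteqP; split=> [g /thompsonV_table[s tg] H [HG sub]|].
  apply: (table_generated HG) tg => u v.
  by apply: generated_swaps => //; apply: sub; [left|right].
apply: smallest_sub; first exact: thompsonV_group.
by move=> _ [] ->; exact: swap_prod_thompsonV.
Qed.
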